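(* Let $X, U$ be two independent random matrices taking values in $\mathcal{S}_d^{+}$, where $U$ is super-uniform. Then, for any deterministic $A \in \mathcal{S}_d^{++}$, $$\mathbb{P}\left(X \succeq A^{1/2} U A^{1/2}\right) \leq \frac{1}{d}\operatorname{tr}\left((\mathbb{E} X) A^{-1}\right).$$
   Context: $\mathcal{S}_d$ denotes the set of $d\times d$ real symmetric matrices, $\mathcal{S}_d^{+}$ the positive semidefinite ones and $\mathcal{S}_d^{++}$ the positive definite ones. The Loewner order: for $A,B\in\mathcal{S}_d$, $A \preceq B$ (equivalently $B\succeq A$) means $B-A$ is positive semidefinite. An $\mathcal{S}_d^{+}$-valued random matrix $U$ is called super-uniform if $\mathbb{P}(U \preceq Z) \leq \operatorname{tr}(Z)/d$ for all (deterministic) $Z \in \mathcal{S}_d^{+}$. Powers of positive semidefinite matrices are defined through the eigenvalues. Expectations of random matrices are entrywise and are assumed to exist when written. *)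

(* Defs.v *)
From mathcomp Require Import all_boot all_order all_algebra.
From mathcomp Require Import all_classical all_reals all_analysis.

Set Implicit Arguments.
Unset Strict Implicit.
Unset Printing Implicit Defensive.

Import Order.TTheory GRing.Theory Num.Theory.
Import numFieldNormedType.Exports.

Local Open Scope classical_set_scope.
Local Open Scope ring_scope.

Definition psdmx (R : realType) (n : nat) (A : 'M[R]_n) : Prop :=
  A \is symmetricmx /\ forall v : 'cV[R]_n, 0 <= (v^T *m A *m v) 0 0.

Definition pdmx (R : realType) (n : nat) (A : 'M[R]_n) : Prop :=
  A \is symmetricmx /\
  forall v : 'cV[R]_n, v != 0 -> 0 < (v^T *m A *m v) 0 0.

(* The Loewner order on matrices. *)
Definition loewner_le (R : realType) (n : nat) (A B : 'M[R]_n) : Prop :=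
  psdmx (B - A).

Definition is_mxpow (R : realType) (n : nat) (A : 'M[R]_n) (p : R)
    (B : 'M[R]_n) : Prop :=
  exists (Q : 'M[R]_n) (l : 'rV[R]_n),
    [/\ Q^T *m Q = 1%:M,
        A = Q *m diag_mx l *m Q^T &
        B = Q *m diag_mx (map_mx (fun x => x `^ p) l) *m Q^T].

(* For positive semidefinite A the spectral theorem provides exactly one B
   such that is_mxpow A p B.  The default value 0 is only reached when A is not
   orthogonally diagonalizable, i.e., not symmetric.  As powR is only
   meaningful on nonnegative reals, so is mxpow on positive semidefinite
   matrices. *)
Definition mxpow (R : realType) (n : nat) (A : 'M[R]_n) (p : R) : 'M[R]_n :=
  xget 0 [set B | is_mxpow A p B].

(* The type of n x n real matrices with its Borel sigma-algebra. *)
Definition borelmx (R : realType) (n : nat) :=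
  g_sigma_algebraType (@open ('M[R]_n : topologicalType)).

Definition independent_RV (R : realType) (d d1 d2 : measure_display)
    (T : measurableType d) (T1 : measurableType d1) (T2 : measurableType d2)
    (P : probability T R) (X : {RV P >-> T1}) (Y : {RV P >-> T2}) : Prop :=
  forall (B : set T1) (C : set T2), measurable B -> measurable C ->
    P (X @^-1` B `&` Y @^-1` C) = (P (X @^-1` B) * P (Y @^-1` C))%E.

Definition integrable_mx (R : realType) (d : measure_display)
    (T : measurableType d) (P : probability T R) (n : nat)
    (X : T -> 'M[R]_n) : Prop :=
  forall i j, P.-integrable setT (EFin \o (fun t => X t i j)).

Definition expectation_mx (R : realType) (d : measure_display)
    (T : measurableType d) (P : probability T R) (n : nat)
    (X : T -> 'M[R]_n) : 'M[R]_n :=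
  \matrix_(i, j) fine 'E_P[fun t => X t i j].

Definition super_uniform (R : realType) (d : measure_display)
    (T : measurableType d) (P : probability T R) (n : nat)
    (U : T -> 'M[R]_n) : Prop :=
  forall Z : 'M[R]_n, psdmx Z ->
    (P [set t | loewner_le (U t) Z] <= (\tr Z / n%:R)%:E)%E.

(* Main.v *)
Require Import Defs.
From mathcomp Require Import all_boot all_order all_algebra.
From mathcomp Require Import all_classical all_reals all_analysis.
From mathcomp Require Import complex measurable_realfun.

(* Put B = A^{1/2}, which is symmetric and invertible with B^2 = A.  Congruence
   by B^{-1} turns the event into U <= B^{-1} X B^{-1}.  By independence its
   probability is the average over X of P(U <= B^{-1} X B^{-1}), at most
   tr(B^{-1} X B^{-1}) / d = tr(X A^{-1}) / d by super-uniformity, and the trace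
   commutes with the expectation. *)

Set Implicit Arguments.
Unset Strict Implicit.
Unset Printing Implicit Defensive.

Import Order.TTheory GRing.Theory Num.Theory.
Import numFieldNormedType.Exports.

Local Open Scope classical_set_scope.
Local Open Scope ring_scope.

(** * Spectral theorem for real symmetric matrices *)

Lemma trmx_symmetric (R : fieldType) n (A : 'M[R]_n) :
  A \is symmetricmx -> A^T = A.
Proof. by move/is_hermitianmxP; rewrite expr0 scale1r map_mx_id. Qed.

Lemma symmetric_trmx (R : fieldType) n (A : 'M[R]_n) :
  A^T = A -> A \is symmetricmx.
Proof.
by move=> sA; apply/is_hermitianmxP; rewrite expr0 scale1r map_mx_id.
Qed.

Lemma dot_cVE (R : comNzRingType) n (u v : 'cV[R]_n) :
  (u^T *m v) 0 0 = \sum_i u i 0 * v i 0.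
Proof. by rewrite mxE; apply: eq_bigr => i _; rewrite mxE. Qed.

Lemma sqnorm_gt0 (R : realDomainType) n (u : 'cV[R]_n) :
  u != 0 -> 0 < (u^T *m u) 0 0.
Proof.
move=> u0; rewrite lt_def dot_cVE.
rewrite sumr_ge0 ?andbT => [|i _]; last exact: sqr_ge0.
apply: contra u0 => /eqP s0; apply/eqP/colP => i; rewrite mxE.
have p j : true -> 0 <= u j 0 * u j 0 by move=> _; exact: sqr_ge0.
by have /eqP := @psumr_eq0P _ _ _ _ p s0 i isT; rewrite mulf_eq0 orbb => /eqP.
Qed.

(* An eigenvalue of the complexification is a Rayleigh quotient, hence real. *)
Lemma symmetric_eigenvalue (R : rcfType) n (A : 'M[R]_n) :
  (0 < n)%N -> A^T = A -> exists a, eigenvalue A a.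
Proof.
move=> n0 sA; pose f := real_complex R.
have [z] := eigenvalue_closed (map_mx f A) n0.
move=> /[dup] /eigenvalueP [v vA v0] ez.
suff zr : z = f (complex.Re z).
  exists (complex.Re z); rewrite eigenvalue_root_char -(fmorph_root f).
  by rewrite map_char_poly -eigenvalue_root_char [X in eigenvalue _ X](esym zr).
pose w := map_mx Num.conj v^T.
have fA : map_mx Num.conj (map_mx f A) = map_mx f A.
  by apply/matrixP => i j; rewrite !mxE; exact: conjc_real.
have wA : map_mx f A *m w = Num.conj z *: w.
  move/(congr1 (fun X => map_mx Num.conj X^T)): vA.
  by rewrite trmx_mul map_mxM [X in map_mx _ X *m _]map_trmx sA fA linearZ /=
    map_mxZ.
(* As [w] is the conjugate transpose of [v], this product is the squared norm of [v]. *)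
have : (v *m w) 0 0 != 0.
  rewrite mxE; apply: contra v0 => /eqP s0; apply/eqP/rowP => i; rewrite mxE.
  have p j : true -> 0 <= v 0 j * w j 0
    by move=> _; rewrite !mxE; exact: mul_conjC_ge0.
  have /eqP := @psumr_eq0P _ _ _ _ p s0 i isT.
  by rewrite !mxE mul_conjC_eq0 => /eqP.
(* Evaluating v A w from the left gives the factor [z], from the right its conjugate. *)
have : z * (v *m w) 0 0 = Num.conj z * (v *m w) 0 0.
  transitivity ((v *m map_mx f A *m w) 0 0).
    by rewrite vA -scalemxAl [RHS]mxE.
  by rewrite -mulmxA wA -scalemxAr [LHS]mxE.
move=> /[swap] s0 /(mulIf s0); case: z {ez vA wA} => x y [] /eqP.
rewrite -addr_eq0 -mulr2n mulrn_eq0 /= => /eqP y0.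
by rewrite y0.
Qed.

Lemma symmetric_unit_eigenvector (R : rcfType) n (A : 'M[R]_n) :
  (0 < n)%N -> A^T = A ->
  exists (a : R) (u : 'cV[R]_n), A *m u = a *: u /\ u^T *m u = 1%:M.
Proof.
move=> n0 sA; have [a /eigenvalueP [v vA v0]] := symmetric_eigenvalue n0 sA.
have vT0 : v^T != 0 by rewrite trmx_eq0.
pose c := Num.sqrt ((v^T^T *m v^T) 0 0).
have /sqnorm_gt0 c0 := vT0.
exists a, (c^-1 *: v^T); split.
  by rewrite -scalemxAr -{1}sA -trmx_mul vA linearZ scalerA /= mulrC -scalerA.
rewrite -scalemxAr linearZ -scalemxAl scalerA [_ *m _]mx11_scalar.
rewrite scale_scalar_mx -invfM -expr2 sqr_sqrtr ?ltW// mulVf //.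
by rewrite gt_eqF.
Qed.

(* The Householder reflection exchanging u and the first basis vector. *)
Lemma householder (R : realFieldType) n (u : 'cV[R]_n.+1) :
  u^T *m u = 1%:M ->
  exists H : 'M[R]_n.+1, [/\ H^T = H, H *m H = 1%:M & H *m delta_mx 0 0 = u].
Proof.
move=> u1; pose e : 'cV[R]_n.+1 := delta_mx 0 0; pose w := u - e.
have [w0|w0] := eqVneq w 0.
  exists 1%:M; rewrite trmx1 !mul1mx; split => //.
  by apply/esym/eqP; rewrite -subr_eq0; apply/eqP.
pose c := (w^T *m w) 0 0; have c0 : c != 0 by rewrite gt_eqF ?sqnorm_gt0.
have wwc : w^T *m w = c%:M by rewrite [LHS]mx11_scalar.
have ee : e^T *m e = 1%:M.
  by rewrite trmx_delta mul_delta_mx; apply/matrixP => i j; rewrite !ord1 !mxE.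
have ue : u^T *m e = e^T *m u.
  by rewrite -[LHS]trmxK trmx_mul trmxK [LHS]mx11_scalar mxE -mx11_scalar.
have wT : w^T = u^T - e^T by rewrite linearB.
(* Since u and e are unit vectors, |w|^2 = 2 - 2 u.e, while w.e = u.e - 1. *)
have we : w^T *m e = (- c / 2)%:M.
  have : (w^T *m w) = (-2) *: (w^T *m e).
    rewrite wT !mulmxBl !mulmxBr u1 ee ue scaleNr scaler_nat mulr2n.
    by rewrite [RHS]opprD opprB.
  rewrite wwc => /(congr1 (fun M => (-2)^-1 *: M)).
  rewrite scalerA mulVf ?oppr_eq0 ?pnatr_eq0// scale1r => <-.
  by rewrite scale_scalar_mx invrN mulrC mulNr mulrN.
pose W := w *m w^T.
have WW : W *m W = c *: W.
  by rewrite /W mulmxA -(mulmxA w) wwc -mulmxA mul_scalar_mx -scalemxAr.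
pose k := 2 / c; have kc : k * c = 2 by rewrite divfK.
(* The reflection in the hyperplane orthogonal to w = u - e; by [we] it sends e to e + w = u. *)
exists (1%:M - k *: W); split.
- by rewrite linearB linearZ /= trmx1 trmx_mul trmxK.
- rewrite mulmxBl !mulmxBr !mul1mx mulmx1 -scalemxAl -scalemxAr WW !scalerA.
  have -> : k * k * c = k + k by rewrite -(mulrA k) kc mulr_natr mulr2n.
  by rewrite scalerDl opprB addrK subrK.
- rewrite mulmxBl mul1mx -scalemxAl /W -mulmxA we mul_mx_scalar scalerA.
  have -> : k * (- c / 2) = -1 by rewrite mulrA mulrN kc mulNr divff ?pnatr_eq0.
  by rewrite scaleN1r opprK addrC subrK.
Qed.

(** Induction on the dimension by deflation: a reflection [H] carries the first basis vector to a
    unit eigenvector, so H A H is block diagonal by symmetry, and the induction hypothesis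
    diagonalizes its lower block. *)
Lemma spectral_symmetric (R : rcfType) n (A : 'M[R]_n) :
  A^T = A -> exists (Q : 'M[R]_n) (l : 'rV[R]_n),
    Q^T *m Q = 1%:M /\ A = Q *m diag_mx l *m Q^T.
Proof.
elim: n A => [|n IHn] A sA.
  by exists 1%:M, 0; split; apply/matrixP => -[].
have [a [u [uA u1]]] := symmetric_unit_eigenvector (ltn0Sn n) sA.
have [H [sH HH Hu]] := householder u1.
have [B Bdef] : exists B, B = H *m A *m H by exists (H *m A *m H).
have sB : B^T = B by rewrite Bdef !trmx_mul sA sH mulmxA.
have Be : B *m delta_mx 0 0 = a *: (delta_mx 0 0 : 'cV_n.+1).
  rewrite Bdef -mulmxA Hu -mulmxA uA -scalemxAr; congr (_ *: _).
  by rewrite -Hu mulmxA HH mul1mx.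
(* The first column of [B] is [a] times the first basis vector; the symmetry of [B] then clears the
   first row as well. *)
have B0 (i : 'I_(1 + n)) (j : 'I_1) :
    B i (lshift n j) = (i == lshift n j)%:R * a.
  have -> : lshift n j = 0 :> 'I_n.+1 by apply/val_inj; rewrite /= ord1.
  by have /matrixP/(_ i 0) := Be; rewrite -colE !mxE eqxx andbT mulrC.
pose C := @drsubmx _ 1 n 1 n B.
have sC : C^T = C by rewrite trmx_drsub sB.
have BE : B = @block_mx _ 1 n 1 n a%:M 0 0 C.
  rewrite -[LHS](@submxK _ 1 n 1 n); congr (@block_mx _ 1 n 1 n _ _ _ _).
  - by apply/matrixP => i j; rewrite !mxE B0 !ord1 eqxx mul1r.
  - by apply/matrixP => i j; rewrite -[in LHS]sB !mxE B0 eq_rlshift mul0r.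
  - by apply/matrixP => i j; rewrite !mxE B0 eq_rlshift mul0r.
have [Q [l [Q1 CE]]] := IHn C sC.
pose S : 'M[R]_n.+1 := @block_mx _ 1 n 1 n 1%:M 0 0 Q.
have ST : S^T = @block_mx _ 1 n 1 n 1%:M 0 0 Q^T.
  by rewrite (@tr_block_mx _ 1 n 1 n) !trmx0 trmx1.
have SE : S = @block_mx _ 1 n 1 n 1%:M 0 0 Q by [].
exists (H *m S), (row_mx a%:M l); split.
  rewrite trmx_mul sH mulmxA -(mulmxA _ H H) HH mulmx1 ST SE.
  rewrite (@mulmx_block _ 1 n 1 n 1 n) !mulmx0 !mul0mx !add0r !addr0 mulmx1 Q1.
  by rewrite -scalar_mx_block.
have -> : A = H *m B *m H.
  by rewrite Bdef !mulmxA HH mul1mx -mulmxA HH mulmx1.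
rewrite trmx_mul sH -!mulmxA; congr (_ *m _); rewrite !mulmxA; congr (_ *m _).
have -> : diag_mx (row_mx a%:M l : 'rV_n.+1) =
    @block_mx _ 1 n 1 n (diag_mx a%:M) 0 0 (diag_mx l).
  exact: (@diag_mx_row _ n 1).
rewrite ST SE !(@mulmx_block _ 1 n 1 n 1 n).
rewrite !mulmx0 !mul0mx !add0r !addr0 mulmx1 mul1mx BE CE.
congr (@block_mx _ 1 n 1 n _ _ _ _); rewrite ?mul0mx //.
by apply/matrixP => i j; rewrite !ord1 !mxE.
Qed.

(** * Congruence, invertibility and the square root *)

Lemma psdmx_congr (R : realType) n (M N : 'M[R]_n) :
  psdmx M -> psdmx (N^T *m M *m N).
Proof.
move=> [/trmx_symmetric sM pM]; split.
  by apply: symmetric_trmx; rewrite !trmx_mul trmxK sM mulmxA.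
by move=> v; have := pM (N *m v); rewrite trmx_mul !mulmxA.
Qed.

Lemma pdmx_unit (R : realType) n (A : 'M[R]_n) : pdmx A -> A \in unitmx.
Proof.
move=> [_ pA]; rewrite unitmxE unitfE; apply/det0P => -[v v0 vA].
have := pA v^T; rewrite trmx_eq0 trmxK vA mul0mx mxE ltxx.
by move=> /(_ v0).
Qed.

(** The spectral theorem only ensures that [xget] does not fall back on its default; the computation
    then works for whichever diagonalization witnesses the chosen value. *)
Lemma mxpow_half (R : realType) n (A : 'M[R]_n) : psdmx A ->
  (mxpow A 2^-1)^T = mxpow A 2^-1 /\ mxpow A 2^-1 *m mxpow A 2^-1 = A.
Proof.
move=> [/trmx_symmetric sA pA].
have [Q0 [l0 [Q01 AE0]]] := spectral_symmetric sA.
have : is_mxpow A 2^-1 (mxpow A 2^-1).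
  apply: xgetPex.
  by exists (Q0 *m diag_mx (map_mx (fun x => x `^ 2^-1) l0) *m Q0^T), Q0, l0.
move: (mxpow _ _) => _ [Q [l [Q1 AE ->]]].
have l_ge0 i : 0 <= l 0 i.
  (* The quadratic form of A at the i-th column of [Q] is the i-th eigenvalue. *)
  have := pA (Q *m delta_mx i 0).
  rewrite {1}AE trmx_mul !mulmxA -(mulmxA _ Q^T Q) Q1 mulmx1.
  rewrite -!mulmxA (mulmxA Q^T) Q1 mul1mx mul_diag_mx trmx_delta -rowE !mxE.
  by rewrite !eqxx mulr1.
split; first by rewrite !trmx_mul trmxK tr_diag_mx mulmxA.
rewrite !mulmxA -(mulmxA _ Q^T Q) Q1 mulmx1 -(mulmxA Q) mulmx_diag AE.
congr (_ *m diag_mx _ *m _); apply/rowP => i.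
by rewrite !mxE powR12_sqrt // -expr2 sqr_sqrtr.
Qed.

(** * Measurability of the event *)

Lemma qformE (R : comNzRingType) n (M : 'M[R]_n) (v : 'cV[R]_n) :
  (v^T *m M *m v) 0 0 = \sum_i \sum_j v j 0 * M j i * v i 0.
Proof.
rewrite mxE; apply: eq_bigr => i _; rewrite mxE mulr_suml.
by apply: eq_bigr => j _; rewrite mxE.
Qed.

(** Continuity in the vector reduces positivity to rational vectors; continuity in the matrix,
    proved next, makes each single constraint Borel. *)
Lemma continuous_qform (R : realType) n (M : 'M[R]_n) :
  continuous (fun v : 'cV[R]_n => (v^T *m M *m v) 0 0).
Proof.
rewrite (funext (qformE M)).
apply: (@continuous_big R _ +%R) => [|i _]; first exact: add_continuous.
apply: (@continuous_big R _ +%R) => [|j _ v]; first exact: add_continuous.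
have c k : {for v, continuous (fun u : 'cV[R]_n => u k 0)}.
  exact: coord_continuous.
have cM : {for v, continuous (fun=> M j i)} by exact: cst_continuous.
exact: (continuousM (continuousM (c j) cM) (c i)).
Qed.

Lemma continuous_qform_mx (R : realType) n (v : 'cV[R]_n) :
  continuous (fun M : 'M[R]_n => (v^T *m M *m v) 0 0).
Proof.
rewrite (funext (fun M => qformE M v)).
apply: (@continuous_big R _ +%R) => [|i _]; first exact: add_continuous.
apply: (@continuous_big R _ +%R) => [|j _ M]; first exact: add_continuous.
have c : {for M, continuous (fun N : 'M[R]_n => N j i)}.
  exact: coord_continuous.
have cc (a : R) : {for M, continuous (fun=> a)} by exact: cst_continuous.
exact: (continuousM (continuousM (cc (v j 0)) c) (cc (v i 0))).
Qed.

Lemma continuous_ge0_rat (R : realType) n (f : 'cV[R]_n -> R) :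
  continuous f -> (forall w : 'cV[rat]_n, 0 <= f (map_mx ratr w)) ->
  forall v, 0 <= f v.
Proof.
move=> cf f0 v; rewrite leNgt; apply/negP => fv.
have /nbhs_ballP[e /= e0 eN] : nbhs v [set u | f u < 0].
  exact: (cf v _ (lt_nbhsl fv)).
(* If f is negative at v, it is negative on a ball around v, where a rational vector is found
   coordinate by coordinate. *)
have q i : {r : rat | ball (v i 0) e (ratr r)}.
  apply: cid; have : v i 0 - e < v i 0 + e by rewrite ltrD2l gtrN.
  by move=> /rat_in_itvoo[r rv]; exists r; rewrite ball_itv.
have := f0 (\col_i sval (q i)); rewrite leNgt => /negP; apply.
apply: eN; split => // i j; rewrite !mxE ord1; exact: (svalP (q i)).
Qed.

Lemma continuous_borelmx_measurable (R : realType) n (f : 'M[R]_n -> R) :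
  continuous f -> measurable_fun setT (f : borelmx R n -> R).
Proof.
move=> /continuousP cf.
apply: (measurability _ (RGenOpens.measurableE R)).
move=> _ [_ [a [b ->]] <-]; rewrite setTI.
by apply: sub_sigma_algebra; apply: cf; exact: interval_open.
Qed.

(* By density, rational vectors suffice: the set is a countable intersection. *)
Lemma measurable_qform_le (R : realType) n (B : 'M[R]_n) :
  measurable [set xu : borelmx R n * borelmx R n |
    forall v : 'cV[R]_n, ((B *m v)^T *m xu.2 *m (B *m v)) 0 0
                         <= (v^T *m xu.1 *m v) 0 0].
Proof.
pose F (v : 'cV[R]_n) := [set xu : borelmx R n * borelmx R n |
  ((B *m v)^T *m xu.2 *m (B *m v)) 0 0 <= (v^T *m xu.1 *m v) 0 0].
(* An enumeration of the rational vectors; codes that decode to nothing yield the zero vector, which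
   is itself rational. *)
pose w (k : nat) : 'cV[rat]_n := odflt 0 (unpickle k).
have mq (z : 'cV[R]_n) :
    measurable_fun setT (fun x : borelmx R n => (z^T *m x *m z) 0 0).
  exact: (continuous_borelmx_measurable (@continuous_qform_mx R n z)).
rewrite (_ : mkset _ = \bigcap_k F (map_mx ratr (w k))).
  apply: bigcapT_measurable => k; rewrite -[F _]setTI.
  apply: measurable_fun_le => //.
  - exact: (measurableT_comp (mq _) measurable_snd).
  - exact: (measurableT_comp (mq _) measurable_fst).
apply/seteqP; split => [[x u] xu k _|[x u] /= xu v]; first exact: xu.
rewrite -subr_ge0.
(* Both sides merge into one quadratic form in [z], to which the density argument applies. *)
have E (z : 'cV[R]_n) :
    (z^T *m x *m z) 0 0 - ((B *m z)^T *m u *m (B *m z)) 0 0 =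
    (z^T *m (x - B^T *m u *m B) *m z) 0 0.
  rewrite mulmxBr mulmxBl trmx_mul !mulmxA.
  by rewrite [in RHS]mxE [in X in _ = _ + X]mxE.
rewrite E; move: v; apply: continuous_ge0_rat; first exact: continuous_qform.
move=> r; rewrite -E subr_ge0; have := xu (pickle r) I.
by rewrite /F /w pickleK.
Qed.

(** * Conditioning on one of two independent variables *)

Lemma distribution_xsection (R : realType) (d d1 d2 : measure_display)
    (T : measurableType d) (T1 : measurableType d1) (T2 : measurableType d2)
    (P : probability T R) (Y : {RV P >-> T2}) (S : set (T1 * T2)) (x : T1) :
  distribution P Y (xsection S x) = P [set s | S (x, Y s)].
Proof.
by congr (P _); apply/seteqP; split => s; rewrite /xsection /= inE.
Qed.

Lemma measurable_fun_slice (R : realType) (d d1 d2 : measure_display)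
    (T : measurableType d) (T1 : measurableType d1) (T2 : measurableType d2)
    (P : probability T R) (X : {RV P >-> T1}) (Y : {RV P >-> T2})
    (S : set (T1 * T2)) : measurable S ->
  measurable_fun setT (fun t => P [set s | S (X t, Y s)] : \bar R).
Proof.
move=> mS; under eq_fun do rewrite -distribution_xsection.
exact: (measurableT_comp (measurable_fun_xsection (distribution P Y) mS)).
Qed.

(** Independence says that the law of the pair agrees with the product of the laws on rectangles,
    hence everywhere. The product measure of [S] is by construction the integral of the measures of
    its sections, and a change of variables brings the integral back to [P]. *)
Lemma independent_RV_xsection (R : realType) (d d1 d2 : measure_display)
    (T : measurableType d) (T1 : measurableType d1) (T2 : measurableType d2)
    (P : probability T R) (X : {RV P >-> T1}) (Y : {RV P >-> T2})
    (S : set (T1 * T2)) :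
  independent_RV X Y -> measurable S ->
  P [set t | S (X t, Y t)] =
    (\int[P]_t P [set s | S (X t, Y s)])%E.
Proof.
move=> XY mS.
have mXY : measurable_fun setT (fun t => (X t, Y t)).
  by apply/measurable_fun_pairP; split; exact: measurable_funP.
pose XYm : {mfun T >-> (T1 * T2)%type} := mfun_Sub (mem_set mXY).
transitivity (distribution P XYm S) => //.
rewrite -(product_measure_unique (m1 := distribution P X)
  (m2 := distribution P Y)) //.
rewrite /product_measure1 ge0_integral_pushforward //; last first.
  exact: measurable_fun_xsection.
by apply: eq_integral => t _; rewrite /= distribution_xsection.
Qed.

(** * Trace and expectation *)

Lemma mxtrace_mulEFin (R : numDomainType) n (M N : 'M[R]_n) :
  (\tr (M *m N))%:E = (\sum_i \sum_j (N j i)%:E * (M i j)%:E)%E.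
Proof.
rewrite /mxtrace -sumEFin; apply: eq_bigr => i _.
by rewrite mxE -sumEFin; apply: eq_bigr => j _; rewrite mulrC EFinM.
Qed.

Lemma integrable_mxtrace (R : realType) (d : measure_display)
    (T : measurableType d) (P : probability T R) n (X : T -> 'M[R]_n)
    (M : 'M[R]_n) : integrable_mx P X ->
  P.-integrable setT (fun t => (\tr (X t *m M))%:E).
Proof.
move=> iX; rewrite (funext (fun t => mxtrace_mulEFin (X t) M)).
apply: integrable_sum => // i _; apply: integrable_sum => // j _.
by apply: integrableZl => //; exact: iX.
Qed.

Lemma integral_mxtrace (R : realType) (d : measure_display)
    (T : measurableType d) (P : probability T R) n (X : T -> 'M[R]_n)
    (M : 'M[R]_n) : integrable_mx P X ->
  (\int[P]_t (\tr (X t *m M))%:E = (\tr (expectation_mx P X *m M))%:E)%E.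
Proof.
move=> iX; rewrite mxtrace_mulEFin.
have iXM i j : P.-integrable setT (fun t => (M j i)%:E * (X t i j)%:E)%E.
  by apply: integrableZl => //; exact: iX.
under eq_integral do rewrite mxtrace_mulEFin.
rewrite integral_sum // => [|i]; last exact: integrable_sum.
apply: eq_bigr => i _; rewrite integral_sum //; apply: eq_bigr => j _.
rewrite /expectation_mx mxE fineK ?unlock ?integralZl //; first exact: iX.
by apply: integrable_fin_num => //; exact: iX.
Qed.

Theorem theorem3p2 (R : realType) (disp : measure_display)
  (T : measurableType disp) (P : probability T R)
  (d : nat) (d_gt0 : (0 < d)%N)
  (X U : {RV P >-> borelmx R d})
  (X_psd : forall t : T, psdmx (X t)) (U_psd : forall t : T, psdmx (U t))
  (XU_indep : independent_RV X U)
  (U_su : super_uniform P U)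
  (X_int : integrable_mx P X)
  (A : 'M[R]_d) (A_pd : pdmx A) :
  (P [set t | loewner_le (mxpow A 2^-1 *m U t *m mxpow A 2^-1) (X t)]
     <= (d%:R^-1 * \tr (expectation_mx P X *m invmx A))%:E)%E.
Proof.
have A_psd : psdmx A.
  case: A_pd => sA pA; split => // v; have [->|/pA/ltW //] := eqVneq v 0.
  by rewrite mulmx0 mxE.
have [] := mxpow_half A_psd; set B := mxpow A _ => sB BB.
have uA := pdmx_unit A_pd.
have uB : B \in unitmx by move: uA; rewrite -BB unitmx_mul => /andP[].
pose C := invmx B.
have sC : C^T = C by rewrite /C trmx_inv sB.
have CC : C *m C = invmx A.
  rewrite -[LHS](mulmxK uA) -{1}BB mulmxA (mulmxKV uB).
  by rewrite mulVmx // mul1mx.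
(* Symmetry of the difference is automatic here, so the Loewner condition is exactly the family of
   scalar inequalities defining the measurable set [S] below. *)
have psdE t s : psdmx (X t - B *m U s *m B) <->
    forall v : 'cV[R]_d, ((B *m v)^T *m U s *m (B *m v)) 0 0
                         <= (v^T *m X t *m v) 0 0.
  have E (v : 'cV[R]_d) : (v^T *m (X t - B *m U s *m B) *m v) 0 0 =
      (v^T *m X t *m v) 0 0 - ((B *m v)^T *m U s *m (B *m v)) 0 0.
    by rewrite mulmxBr mulmxBl trmx_mul sB !mulmxA [LHS]mxE [X in _ + X = _]mxE.
  split=> [[_ p] v|p]; first by rewrite -subr_ge0 -E.
  split=> [|v]; last by rewrite E subr_ge0.
  have /trmx_symmetric sX := (X_psd t).1.
  have /trmx_symmetric sU := (U_psd s).1.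
  by apply: symmetric_trmx; rewrite linearB /= !trmx_mul sX sU sB mulmxA.
pose S := [set xu : borelmx R d * borelmx R d | forall v : 'cV[R]_d,
  ((B *m v)^T *m xu.2 *m (B *m v)) 0 0 <= (v^T *m xu.1 *m v) 0 0].
have mS : measurable S by exact: measurable_qform_le.
rewrite /loewner_le (_ : mkset _ = [set t | S (X t, U t)]); last first.
  by apply/seteqP; split => t /psdE.
rewrite (independent_RV_xsection XU_indep mS).
(* With X frozen at [X t], super-uniformity is applied to the deterministic matrix C X C, whose
   trace is that of X A^{-1} by cyclicity. *)
have tail t : (P [set s | S (X t, U s)]
               <= (d%:R^-1)%:E * (\tr (X t *m invmx A))%:E)%E.
  have CXC : psdmx (C *m X t *m C).
    by have := psdmx_congr C (X_psd t); rewrite sC.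
  have := U_su _ CXC; rewrite mxtrace_mulC mulmxA CC mxtrace_mulC.
  rewrite -EFinM mulrC; apply: le_trans.
  (* The two events coincide: congruence by [C] leads from X - B U B to C X C - U, and congruence by
     [B] leads back. *)
  rewrite le_eqVlt; apply/orP; left; apply/eqP; congr (P _).
  apply/seteqP; split => s /=.
    move=> /(psdE t s) /psdmx_congr -/(_ C).
    rewrite sC mulmxBr mulmxBl -!mulmxA.
    by rewrite mulmxV // mulmx1 mulKmx // mulmxA.
  move=> /psdmx_congr -/(_ B); rewrite sB mulmxBr mulmxBl -!mulmxA.
  by rewrite mulVmx // mulmx1 mulKVmx // mulmxA => /(psdE t s).
have iXA := integrable_mxtrace (invmx A) X_int.
(* The right-hand side becomes the integral of the pointwise bound [tail], so monotonicity of the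
   integral concludes. *)
rewrite EFinM -integral_mxtrace // -integralZl //.
apply: ge0_le_integral => //; first exact: measurable_fun_slice.
by apply: (measurable_int P); apply: integrableZl.
Qed.
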